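(* There exists a constant $c$ such that the following holds for every positive integer $n$. Let $X$ be a finite set and let $A_1,\ldots,A_n$ be $n$ equivalence relations on $X$ with kernels $K_1,\ldots,K_n$, respectively. Suppose that $|K_i|\ge (3+\tfrac15)n+c$ for each $i\in\{1,\ldots,n\}$. Then $A_1,\ldots,A_n$ have a rainbow matching.
   Context: For an equivalence relation $A_i$ on $X$, write $a\sim_i b$ if $a,b\in X$ are equivalent under $A_i$, and let $[a]_i=\{b\in X: a\sim_i b\}$ be the class of $a$. The kernel of $A_i$ is $K_i=\{a\in X: |[a]_i|>1\}$. A rainbow matching of $A_1,\ldots,A_n$ is a set of $2n$ pairwise distinct elements $a_1,b_1,\ldots,a_n,b_n\in X$ such that $a_i\sim_i b_i$ for each $i\in\{1,\ldots,n\}$. *)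

(* Defs.v *)
From mathcomp Require Import all_boot all_order all_algebra.

Set Implicit Arguments.
Unset Strict Implicit.
Unset Printing Implicit Defensive.

Definition eq_class (X : finType) (e : rel X) (a : X) : {set X} :=
  [set b | e a b].

Definition kernel (X : finType) (e : rel X) : {set X} :=
  [set a | 1 < #|eq_class e a|].

(* The 2n elements of a rainbow matching are given as two families a, b indexed
   by 'I_n; the first three conjuncts say that they are pairwise distinct. *)
Definition rainbow_matching (X : finType) (n : nat) (A : 'I_n -> rel X)
    (a b : 'I_n -> X) : Prop :=
  [/\ injective a,
      injective b,
      forall i j : 'I_n, a i != b j
    & forall i : 'I_n, A i (a i) (b i)].

Definition has_rainbow_matching (X : finType) (n : nat)
    (A : 'I_n -> rel X) : Prop :=
  exists a b : 'I_n -> X, rainbow_matching A a b.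

(* Main.v *)
Require Import Defs.
From mathcomp Require Import all_boot all_order all_algebra.
From mathcomp Require Import zify lra.

(** Induct on the number of colours. Suppose that a set S of colours has no
rainbow matching, but that S without z has one, f; let V be the set of its
2(n-1) covered vertices. The idea is to move the hole: if colour z has an edge
from an end of the f-edge of colour i to a vertex u outside V, colour z can take
that edge instead, and then i is the colour without an edge. Iterating at most d
times, one gets the colours that are switchable at depth d; each comes with a
matching of the other colours that agrees with f on all but d+1 colours and
covers at most d vertices outside V ([switched]).

A colour k switchable at depth d has no edge between two vertices that are free
in its switched matching, for such an edge would fill the hole. So all but O(d)
of the kernel vertices of k outside V are joined by k to V, and by distinct
vertices of V since two of them with a common neighbour would be equivalent.
As the kernel has (16/5)n + c vertices, k has at least (6/5)n + c' such hits
([exists_hitting]). An f-edge of colour i can be hit by k at most twice, and if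
it is hit at all then, up to O(d) exceptions, i is switchable at depth d+1
([switched_step]).

Hits among switchable colours are nearly antisymmetric: if k hits both ends of
the f-edge of i, then i essentially does not hit the f-edge of k. Indeed, let j
be another switchable colour that hits both ends of the f-edge of i. Starting
from the matching without j, give one end of this edge to j and the other one to
k; this frees i and both ends of the f-edge of k, one of which i can use
([rainbow_rotate]). The obstacle is that the vertices used by the switched
matching of j may be those that k needs. For this, j is drawn from a bounded
subfamily of the candidates that has the same set of common obstructions as the
whole family ([small_subfamily_same_inter]); k itself belongs to the family and
its switched matching does not obstruct it. So for every i only O(d^2) colours k
are exceptional ([few_mutual_hits]).

If F and F' are the sets of colours switchable at depth d and d+1, a colour of F
thus makes on average at most |F| + O(d^2) hits inside F, and at most
2|F' \ F| + O(d) hits elsewhere. Since the depths 0, ..., 5 give an increasing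
chain of at most n colours, some d < 5 has |F' \ F| <= n/5, and then the average
is at most |F'| + |F' \ F| + O(1) <= (6/5)n + O(1), which contradicts the lower
bound on the number of hits when c is large. *)

Set Implicit Arguments.
Unset Strict Implicit.
Unset Printing Implicit Defensive.

(** * Counting *)

Lemma card_bigcup_le (J T : finType) (D : {set J}) (B : J -> {set T}) s :
  (forall j, j \in D -> #|B j| <= s) -> #|\bigcup_(j in D) B j| <= #|D| * s.
Proof.
move=> Bs; apply: leq_trans (_ : \sum_(j in D) #|B j| <= _).
  apply: (big_ind2 (fun (U : {set T}) n => #|U| <= n)) => //; first by rewrite cards0.
  move=> U m U' m' Um Um'; have [+ _] := leq_card_setU U U'.
  by move=> /leq_trans-> //; apply: leq_add.
by rewrite -sum_nat_const; apply: leq_sum.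
Qed.

(** One set B j0 already bounds the intersection of the family, and each of its
at most s elements that is not common to all sets is excluded by a single
further set. *)
Lemma small_subfamily_same_inter (J T : finType) (D : {set J}) (B : J -> {set T}) s :
  (forall j, j \in D -> #|B j| <= s) ->
  exists D' : {set J}, [/\ D' \subset D, #|D'| <= s.+1
    & forall x, (forall j, j \in D' -> x \in B j) ->
                forall j, j \in D -> x \in B j].
Proof.
move=> Bs; have [->|[j0 j0D]] := set_0Vmem D.
  by exists set0; rewrite sub0set cards0; split=> // x _ j; rewrite inE.
pose w x := odflt j0 [pick j | (j \in D) && (x \notin B j)].
exists (j0 |: w @: B j0); split.
- apply/subsetP => j; rewrite inE => /orP[|/imsetP[x _ ->]].
    by rewrite inE => /eqP ->.
  by rewrite /w; case: pickP => //= j' /andP[].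
- apply: leq_trans (_ : 1 + #|w @: B j0| <= _); first by rewrite cardsU1; case: (_ \notin _).
  by rewrite ltnS; apply: leq_trans (leq_imset_card _ _) (Bs _ j0D).
- move=> x xB j jD; apply: contraT => xj.
  have x0 : x \in B j0 by apply: xB; rewrite setU11.
  have : x \in B (w x) by apply: xB; rewrite setU1r ?imset_f.
  rewrite /w; case: pickP => /= [j' /andP[_ /negPf ->] //|/(_ j)].
  by rewrite jD xj.
Qed.

Lemma leq_sum_cond (I : finType) (P Q : pred I) (E1 E2 : I -> nat) :
  (forall i, P i -> E1 i <= if Q i then E2 i else 0) ->
  \sum_(i | P i) E1 i <= \sum_(i | Q i) E2 i.
Proof.
move=> le; rewrite (big_mkcond P) (big_mkcond Q) /=.
by apply: leq_sum => i _; case: ifP => // /le.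
Qed.

(** Read hit k i as the number of hits of colour k on the edge of colour i. For
k, i in F, hit k i + hit i k exceeds 2 only if one of them is 2 and the other is
positive, which is exceptional; so the mean of hit over F x F is at most about 1.
Outside F, only the colours of F' and the exceptional ones of C k are hit. *)
Lemma hits_double_counting (I : finType) (F F' : {set I}) (hit : I -> I -> nat)
    (C : I -> {set I}) p c e :
  F != set0 -> F \subset F' ->
  (forall k i, k \in F -> hit k i <= 2) ->
  (forall k, k \in F -> p <= \sum_i hit k i) ->
  (forall k i, k \in F -> i \notin C k -> 0 < hit k i -> i \in F') ->
  (forall k, k \in F -> #|C k| <= c) ->
  (forall i, i \in F ->
    #|[set k in F | [&& hit k i == 2, 0 < hit i k & i \notin C k]]| <= e) ->
  p + #|F| <= 2 * #|F'| + 3 * c + e.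
Proof.
move=> F0 FF' hit2 hitp hitF' Cc few.
pose bad k i := (hit k i == 2) && (0 < hit i k) : nat.
have outside k : k \in F -> \sum_(i | i \notin F) hit k i <= 2 * (#|F'| - #|F|) + 2 * c.
  move=> kF; apply: leq_trans (_ : \sum_(i in (F' :\: F) :|: C k) 2 <= _); last first.
    rewrite sum_nat_const; have [+ _] := leq_card_setU (F' :\: F) (C k).
    have := Cc k kF; rewrite cardsD (setIidPr FF'); lia.
  apply: leq_sum_cond => i iF; case: ifP => [_|/negbT]; first exact: hit2.
  rewrite !inE iF /= => /norP[iF' iC]; rewrite leqNgt.
  by apply: contraNN iF'; apply: hitF'.
(* Exceptional pairs have i in C k (at most c for each k), or are few for each i. *)
have nbad : \sum_(i in F) \sum_(k in F) bad k i <= #|F| * (c + e).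
  apply: leq_trans (_ : \sum_(i in F) \sum_(k in F)
     ((i \in C k) + [&& hit k i == 2, 0 < hit i k & i \notin C k]) <= _).
    apply: leq_sum => i _; apply: leq_sum => k _; rewrite /bad.
    by case: (i \in C k) (hit k i == 2) (0 < hit i k) => [] [] [].
  under eq_bigr => i _ do rewrite big_split /=.
  rewrite big_split /= mulnDr leq_add //.
    rewrite exchange_big /= -sum_nat_const; apply: leq_sum => k kF.
    apply: leq_trans (Cc k kF); rewrite -sum1_card.
    by apply: leq_sum_cond => i _; case: (i \in C k).
  rewrite -sum_nat_const; apply: leq_sum => i iF; apply: leq_trans (few i iF).
  by rewrite -sum1_card; apply: leq_sum_cond => k kF; rewrite inE kF /=; case: ifP.
(* Symmetrize; the two values of bad make up for the sums 3 = 2 + 1 and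
   4 = 2 + 2, and the diagonal is covered as well. *)
have inside : \sum_(k in F) \sum_(i in F) hit k i <= #|F| * #|F| + #|F| * (c + e).
  suff : 2 * (\sum_(k in F) \sum_(i in F) hit k i) <=
         2 * (#|F| * #|F|) + 2 * (\sum_(i in F) \sum_(k in F) bad k i) by lia.
  have sym (g : I -> I -> nat) : 2 * (\sum_(k in F) \sum_(i in F) g k i) =
      \sum_(k in F) \sum_(i in F) (g k i + g i k).
    under [RHS]eq_bigr => k _ do rewrite big_split /=.
    by rewrite big_split /= [X in _ = _ + X]exchange_big /= mul2n addnn.
  rewrite [X in _ + 2 * X]exchange_big /= !sym.
  have -> : 2 * (#|F| * #|F|) = \sum_(k in F) \sum_(i in F) 2.
    under eq_bigr => k _ do rewrite sum_nat_const.
    by rewrite sum_nat_const; lia.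
  rewrite -big_split; apply: leq_sum => k kF /=.
  rewrite -big_split; apply: leq_sum => i iF /=; rewrite /bad.
  have := hit2 k i kF; have := hit2 i k iF.
  by case: (hit k i) (hit i k) => [|[|[|?]]] [|[|[|?]]].
have F_gt0 : 0 < #|F| by rewrite card_gt0.
have cFF' := subset_leq_card FF'.
rewrite -(leq_pmul2l F_gt0) mulnDr.
have : #|F| * p <= \sum_(k in F) \sum_i hit k i.
  by rewrite -sum_nat_const; apply: leq_sum.
have -> : \sum_(k in F) \sum_i hit k i =
   \sum_(k in F) \sum_(i in F) hit k i + \sum_(k in F) \sum_(i | i \notin F) hit k i.
  by rewrite -big_split; apply: eq_bigr => k _; rewrite (bigID (mem F)).
have : \sum_(k in F) \sum_(i | i \notin F) hit k i <= #|F| * (2 * (#|F'| - #|F|) + 2 * c).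
  by rewrite -sum_nat_const; apply: leq_sum.
nia.
Qed.

(** * Matchings and their modification *)

Section Matchings.
Variables (I X : finType) (A : I -> rel X).
Hypothesis A_equiv : forall i, equivalence_rel (A i).

Let A_sym i : symmetric (A i).
Proof.
have /equivalence_relP[rf lt] := A_equiv i.
by move=> x y; apply/idP/idP => /lt <-; apply: rf.
Qed.

Let A_trans i x y w : A i x y -> A i y w -> A i x w.
Proof. by have /equivalence_relP[rf lt] := A_equiv i; move=> /lt ->. Qed.

Notation matching := {ffun I * bool -> X}.
Implicit Types (S : {set I}) (m : matching).

(** A partial matching is encoded by a total family, of which only the colours in
S count; the edge of colour i joins m (i, true) and m (i, false). *)
Definition rainbow_on S m : bool :=
  [forall i in S, A i (m (i, true)) (m (i, false))]
    && dinjectiveb m [pred p | p.1 \in S].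

Lemma rainbow_onP S m :
  reflect ((forall i, i \in S -> A i (m (i, true)) (m (i, false))) /\
           (forall p q, p.1 \in S -> q.1 \in S -> m p = m q -> p = q))
          (rainbow_on S m).
Proof.
apply: (iffP andP) => [[/forall_inP e /dinjectiveP d]|[e d]]; split=> //.
- by apply/forall_inP => i; exact: e.
- by apply/dinjectiveP => p q; rewrite !inE => pS qS; apply: d.
Qed.

Lemma rainbow_onS S S' m : S' \subset S -> rainbow_on S m -> rainbow_on S' m.
Proof.
move=> /subsetP sS /rainbow_onP[e d]; apply/rainbow_onP; split.
  by move=> i /sS; apply: e.
by move=> p q /sS pS /sS qS; apply: d.
Qed.

Definition covered S m : {set X} := [set m p | p in [pred p | p.1 \in S]].

Lemma coveredP S m x :
  reflect (exists2 p, p.1 \in S & x = m p) (x \in covered S m).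
Proof. by apply: (iffP imsetP) => -[p pS ->]; exists p. Qed.

Lemma mem_covered S m p : p.1 \in S -> m p \in covered S m.
Proof. by move=> pS; apply/coveredP; exists p. Qed.

Lemma coveredS S S' m : S' \subset S -> covered S' m \subset covered S m.
Proof.
by move=> /subsetP sS; apply/subsetP=> x /coveredP[p /sS pS ->]; apply: mem_covered.
Qed.

Lemma card_covered S m : #|covered S m| <= 2 * #|S|.
Proof.
apply: leq_trans (leq_imset_card _ _) _.
have -> : #|[pred p : I * bool | p.1 \in S]| = #|setX S [set: bool]|.
  by apply: eq_card => -[i b]; rewrite !inE andbT.
by rewrite cardsX cardsT card_bool mulnC.
Qed.

Lemma rainbow_uncovered S S' m p :
  rainbow_on S m -> S' \subset S -> p.1 \in S -> p.1 \notin S' ->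
  m p \notin covered S' m.
Proof.
move=> /rainbow_onP[_ d] /subsetP sS pS pS'; apply/coveredP => -[q qS' epq].
by move: pS'; rewrite (d p q pS (sS _ qS') epq) qS'.
Qed.

Definition redraw m i x y : matching :=
  [ffun p => if p.1 == i then if p.2 then x else y else m p].

Lemma redraw_neq m i x y p : p.1 != i -> redraw m i x y p = m p.
Proof. by rewrite ffunE => /negPf ->. Qed.

Lemma covered_redraw S m i x y :
  covered S (redraw m i x y) \subset [set x; y] :|: covered (S :\ i) m.
Proof.
apply/subsetP => _ /coveredP[[k b] /= kS ->]; rewrite ffunE /=.
case: eqVneq => [_|nki]; first by case: b; rewrite !inE eqxx ?orbT.
by rewrite inE mem_covered ?orbT // !inE nki.
Qed.

Lemma rainbow_redraw S m i x y :
  rainbow_on (S :\ i) m -> A i x y -> x != y ->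
  x \notin covered (S :\ i) m -> y \notin covered (S :\ i) m ->
  rainbow_on S (redraw m i x y).
Proof.
move=> /rainbow_onP[e d] Axy nxy xm ym.
have nx p : p.1 \in S -> p.1 != i -> (x == m p) = false.
  by move=> pS pi; apply: contraNF xm => /eqP ->; apply: mem_covered; rewrite !inE pi.
have ny p : p.1 \in S -> p.1 != i -> (y == m p) = false.
  by move=> pS pi; apply: contraNF ym => /eqP ->; apply: mem_covered; rewrite !inE pi.
apply/rainbow_onP; split=> [k kS|[k b] [l c] /= kS lS].
  rewrite !ffunE /=; case: eqVneq => [->//|nki].
  by apply: e; rewrite !inE nki.
rewrite !ffunE /=; case: (eqVneq k i) => [->|nki]; case: (eqVneq l i) => [->|nli].
- by case: b c => [] [] // /eqP; rewrite ?(negPf nxy) // eq_sym (negPf nxy).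
- by case: b => /eqP; rewrite ?nx ?ny.
- by case: c => /eqP; rewrite eq_sym ?nx ?ny.
- by move=> /d -> //; rewrite !inE ?nki ?nli.
Qed.

(** Moves the hole from j to i: colour j takes over one end of the edge of i. *)
Lemma rainbow_switch S m i j b x :
  rainbow_on (S :\ j) m -> i \in S -> i != j ->
  A j (m (i, b)) x -> x \notin covered (S :\ j) m ->
  rainbow_on (S :\ i) (redraw m j (m (i, b)) x).
Proof.
move=> rm iS ij Ax xm.
have sub : S :\ i :\ j \subset S :\ j.
  by apply/subsetP => k; rewrite !inE => /and3P[-> _ ->].
have mm : m (i, b) \in covered (S :\ j) m by apply: mem_covered; rewrite !inE ij.
apply: rainbow_redraw => //.
- exact: rainbow_onS rm.
- by apply: contraNneq xm => <-.
- by apply: (rainbow_uncovered rm) => //=; rewrite !inE ?ij ?eqxx //= andbF.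
- by apply: contraNN xm; apply/subsetP/coveredS.
Qed.

(** The hole at j is filled by a three-fold exchange: j and k each take over one
end of the edge of i, and i takes over an end of the edge that k has given up. *)
Lemma rainbow_rotate S m i j k b c x y w :
  rainbow_on (S :\ j) m -> i \in S -> k \in S -> i != j -> k != j -> i != k ->
  A j (m (i, b)) x -> A k (m (i, ~~ b)) y -> A i (m (k, c)) w ->
  x \notin covered (S :\ j) m -> y \notin covered (S :\ j) m ->
  w \notin covered (S :\ j) m -> x != y -> x != w -> y != w ->
  exists m', rainbow_on S m'.
Proof.
move=> rm iS kS ij kj ik Ax Ay Aw xm ym wm xy xw yw.
have ends p : p.1 = i \/ p.1 = k -> m p \in covered (S :\ j) m.
  by case=> e; apply: mem_covered; rewrite !inE e ?ij ?kj.
have off p v : p.1 = i \/ p.1 = k -> v \notin covered (S :\ j) m -> (m p == v) = false.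
  by move=> /ends pm; apply: contraNF => /eqP <-.
have inj p q : p.1 = i \/ p.1 = k -> q.1 = i \/ q.1 = k -> p != q -> (m p == m q) = false.
  move=> pe qe; apply: contraNF => /eqP; have /rainbow_onP[_ d] := rm.
  move=> /d -> //; [by case: pe => ->; rewrite !inE ?ij ?kj |].
  by case: qe => ->; rewrite !inE ?ij ?kj.
pose S1 := S :\ j :\ i :\ k.
have sub : S1 \subset S :\ j by apply/subsetP => l; rewrite !inE => /and4P[_ _ -> ->].
have unc p : p.1 = i \/ p.1 = k -> m p \in covered S1 m = false.
  move=> pe; apply/negP/negP; apply: (rainbow_uncovered rm) => //.
    by case: pe => ->; rewrite !inE ?ij ?kj.
  by case: pe => ->; rewrite !inE eqxx ?andbF.
have offS v : v \notin covered (S :\ j) m -> v \in covered S1 m = false.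
  by move=> vm; apply/negP => vS; case/negP: vm; apply: (subsetP (coveredS _ sub)).
(* k is redrawn first, i second and j last: no vertex of the old edges of i and k
   is then still covered when it is used again. *)
pose m1 := redraw m k (m (i, ~~ b)) y.
pose m2 := redraw m1 i (m (k, c)) w.
have r1 : rainbow_on (S :\ j :\ i) m1.
  apply: rainbow_redraw => //.
  - exact: rainbow_onS rm.
  - by rewrite off //; left.
  - by rewrite unc //; left.
  - by rewrite offS.
have r2 : rainbow_on (S :\ j) m2.
  have cov v : v != m (i, ~~ b) -> v != y -> v \in covered S1 m = false ->
      v \notin covered (S :\ j :\ i) m1.
    move=> vi vy vS; apply: contraFN vS => /(subsetP (covered_redraw _ _ _ _ _)).
    by rewrite !inE (negPf vi) (negPf vy).
  apply: rainbow_redraw => //.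
  - by rewrite off //; right.
  - apply: cov; [|by rewrite off //; right|by apply: unc; right].
    by rewrite inj ?xpair_eqE 1?(eq_sym k) ?(negPf ik) //; [right|left].
  - by apply: cov; rewrite ?offS // eq_sym // off //; left.
exists (redraw m2 j (m (i, b)) x).
have cov v : v != m (i, ~~ b) -> v != y -> v != m (k, c) -> v != w ->
    v \in covered S1 m = false -> v \notin covered (S :\ j) m2.
  move=> vi vy vk vw vS; apply: contraFN vS => /(subsetP (covered_redraw _ _ _ _ _)).
  rewrite !inE (negPf vk) (negPf vw) /= => /(subsetP (covered_redraw _ _ _ _ _)).
  by rewrite !inE (negPf vi) (negPf vy).
apply: rainbow_redraw => //.
- by rewrite off //; left.
- apply: cov; [|by rewrite off //; left| |by rewrite off //; left|by apply: unc; left].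
    by rewrite inj //; [left|left|rewrite xpair_eqE eqxx /=; case: (b)].
  by rewrite inj ?xpair_eqE ?(negPf ik) //; [left|right].
- by apply: cov; rewrite ?offS // eq_sym off //; [left|right].
Qed.

(** * Switchable colours of a stuck matching *)

Section Switching.
Variables (S : {set I}) (z : I) (f : matching).
Hypothesis zS : z \in S.
Hypothesis rf : rainbow_on (S :\ z) f.
Hypothesis stuck : forall m : matching, ~~ rainbow_on S m.

Let V := covered (S :\ z) f.

(** A matching obtained from f by moving the hole, the vertices outside V that it
may cover, and the colours whose edges may differ from those of f. *)
Record switching := Switching
  { sw_matching : matching; sw_new : {set X}; sw_changed : {set I} }.

Definition switched d i (t : switching) : Prop :=
  [/\ rainbow_on (S :\ i) (sw_matching t),
      covered (S :\ i) (sw_matching t) \subset V :|: sw_new t,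
      #|sw_new t| <= d /\ #|sw_changed t| <= d.+1,
      i \in sw_changed t /\ z \in sw_changed t
    & forall p, p.1 \notin sw_changed t -> sw_matching t p = f p].

Lemma switched_id : switched 0 z (Switching f set0 [set z]).
Proof.
by split; rewrite //= ?cards0 ?cards1 ?set11 ?subsetUl.
Qed.

(** The hole moves on from j to i. The colour i must still have its edge of f,
which is why the changed colours are recorded. *)
Lemma switched_step d i j b u t :
  switched d j t -> i \in S -> i \notin sw_changed t ->
  u \notin V :|: sw_new t -> A j (f (i, b)) u ->
  exists t', switched d.+1 i t'.
Proof.
case: t => m T C [/= rm /subsetP cm [cT cC] [jC zC] eqm] iS iC uVT Au.
have nij : i != j by apply: contraNneq iC => ->.
have niz : i != z by apply: contraNneq iC => ->.
have um : u \notin covered (S :\ j) m by apply: contraNN uVT; apply: cm.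
have Am : A j (m (i, b)) u by rewrite eqm.
exists (Switching (redraw m j (m (i, b)) u) (u |: T) (i |: C)).
split=> /=.
- exact: rainbow_switch.
- apply/subsetP => x /(subsetP (covered_redraw _ _ _ _ _)).
  have sub : S :\ i :\ j \subset S :\ j.
    by apply/subsetP => k; rewrite !inE => /and3P[-> _ ->].
  rewrite in_setU => /orP[|/(subsetP (coveredS _ sub)) /cm].
    rewrite !inE => /orP[/eqP->|->]; last by rewrite orbT.
    by rewrite eqm // mem_covered // !inE niz.
  by rewrite !inE => /orP[->|->]; rewrite ?orbT.
- by rewrite !cardsU1 -(add1n d) -(add1n d.+1) !leq_add ?leq_b1.
- by rewrite setU11 in_setU1 zC orbT.
- move=> p; rewrite in_setU1 negb_or => /andP[_ pC].
  by rewrite redraw_neq ?eqm //; apply: contraNneq pC => ->.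
Qed.

(** An edge between two free vertices would fill the hole. *)
Lemma switched_free d i t u v :
  i \in S -> switched d i t ->
  u \notin V :|: sw_new t -> v \notin V :|: sw_new t -> A i u v -> u = v.
Proof.
move=> iS [rm /subsetP cm _ _ _] uV vV Auv; apply/eqP; apply: contraT => nuv.
case/negP: (stuck (redraw (sw_matching t) i u v)).
by apply: rainbow_redraw => //; [apply: contraNN uV|apply: contraNN vV]; apply: cm.
Qed.

(** Hits of a colour on f: a set of vertices outside V, each with one end of an
f-edge to which the colour joins it. One end per vertex is selected, since an
equivalence class may contain many covered vertices. *)
Record hitting := Hitting { hitters : {set X}; hit_end : X -> I * bool }.

Definition hits i (T : {set X}) (h : hitting) : Prop :=
  [/\ forall u, u \in hitters h -> u \notin V :|: T,
      {in hitters h &, injective (hit_end h)},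
      forall u, u \in hitters h -> (hit_end h u).1 \in S :\ z
    & forall u, u \in hitters h -> A i (f (hit_end h u)) u].

(** Each kernel vertex has a partner in its class, and by [switched_free] distinct
free vertices have distinct partners, all of them in V or among the at most d
new vertices. *)
Lemma exists_hitting d i t :
  i \in S -> switched d i t ->
  exists2 h, hits i (sw_new t) h
    & #|kernel (A i)| <= #|hitters h| + 2 * #|S|.-1 + 2 * d.
Proof.
move=> iS sw; have free := switched_free iS sw.
have [_ _ [cT _] _ _] := sw; set T := sw_new t in cT free *.
pose partner u := odflt u [pick v | (v != u) && A i u v].
(* By default partner u = u; this does not occur on the kernel. *)
pose W := kernel (A i) :\: (V :|: T).
have partnerP u : u \in kernel (A i) -> (partner u != u) && A i u (partner u).
  rewrite inE => /card_gt1P[x [y [xu yu nxy]]]; rewrite /partner.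
  case: pickP => //= no.
  move: xu yu; rewrite !inE => xu yu.
  by have := no x; have := no y; rewrite xu yu !andbT => /negbFE/eqP ey /negbFE/eqP ex; rewrite ex ey eqxx in nxy.
have WP u : u \in W -> u \notin V :|: T /\ partner u \in V :|: T.
  rewrite in_setD => /andP[uVT /partnerP/andP[nu Au]]; split=> //.
  by apply: contraT => pV; move: nu; rewrite -(free _ _ uVT pV Au) eqxx.
have inj : {in W &, injective partner}.
  move=> u v; rewrite !in_setD => /andP[uV /partnerP/andP[_ Au]] /andP[vV /partnerP/andP[_ Av]] e.
  by apply: free uV vV _; apply: A_trans Au _; rewrite e A_sym.
pose P := [set u in W | partner u \in V].
pose e u := odflt (z, true) [pick p | (p.1 \in S :\ z) && (f p == partner u)].
have eP u : u \in P -> (e u).1 \in S :\ z /\ f (e u) = partner u.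
  rewrite inE => /andP[_ /coveredP[p pS ep]]; rewrite /e.
  case: pickP => [q /andP[qS /eqP //]|/(_ p)].
  by rewrite pS ep eqxx.
exists (Hitting P e).
  split=> /=.
  - by move=> u; rewrite inE => /andP[/WP[]].
  - move=> u v uP vP euv; apply: inj; try by move: uP vP; rewrite !inE => /andP[-> _] /andP[].
      by move: vP; rewrite inE => /andP[].
    by have [_ <-] := eP u uP; have [_ <-] := eP v vP; rewrite euv.
  - by move=> u /eP[].
  - move=> u uP; have [_ ->] := eP u uP; rewrite A_sym.
    by move: uP; rewrite inE in_setD -andbA => /and3P[_ /partnerP/andP[]].
have cV : #|V| <= 2 * #|S|.-1.
  by apply: leq_trans (card_covered _ _) _; rewrite (cardsD1 z S) zS.
have cW : #|W :\: P| <= #|T|.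
  rewrite -(card_in_imset (f := partner)); last first.
    by move=> u v /setDP[uW _] /setDP[vW _]; apply: inj.
  apply/subset_leq_card/subsetP => _ /imsetP[u /setDP[uW uP] ->].
  have [_] := WP u uW; rewrite in_setU => /orP[pV|//].
  by rewrite inE uW pV in uP.
have PW : W :&: P = P by apply/setIidPr/subsetP => u; rewrite inE => /andP[].
have := cardsID P W; rewrite PW => cWP.
have : #|kernel (A i)| <= #|V :|: T| + #|W|.
  by rewrite -(cardsID (V :|: T)) leq_add2r subset_leq_card // subsetIr.
have [cVT _] := leq_card_setU V T.
rewrite /= -/P; lia.
Qed.

Definition hit_count (h : hitting) i : nat :=
  #|[set u in hitters h | (hit_end h u).1 == i]|.

Lemma sum_hit_count (h : hitting) : #|hitters h| = \sum_i hit_count h i.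
Proof.
rewrite -sum1_card (partition_big (fun u => (hit_end h u).1) predT) //=.
by apply: eq_bigr => i _; rewrite sum1dep_card.
Qed.

Lemma hit_end_inj2 i T h j : hits i T h ->
  {in [set u in hitters h | (hit_end h u).1 == j] &,
     injective (fun u => (hit_end h u).2)}.
Proof.
move=> [_ inj _ _] u v; rewrite !inE => /andP[uP /eqP eu] /andP[vP /eqP ev] e.
by apply: inj => //; move: eu ev e; case: (hit_end h u) (hit_end h v) => [? ?] [? ?] /= -> -> ->.
Qed.

Lemma hit_count_le2 i T h j : hits i T h -> hit_count h j <= 2.
Proof.
move=> /hit_end_inj2 inj; rewrite /hit_count -(card_in_imset (inj j)).
by apply: leq_trans (max_card _) _; rewrite card_bool.
Qed.

(** The vertex that hits the end p, if there is one; the default f p is a junk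
value. *)
Definition hitter (h : hitting) (p : I * bool) : X :=
  odflt (f p) [pick u in hitters h | hit_end h u == p].

Lemma hitterP i T h j b : hits i T h -> hit_count h j = 2 ->
  hitter h (j, b) \in hitters h /\ hit_end h (hitter h (j, b)) = (j, b).
Proof.
move=> /hit_end_inj2 inj c2; rewrite /hitter.
case: pickP => [u /andP[uP /eqP]//|no].
set D := [set u in hitters h | (hit_end h u).1 == j] in c2 *.
suff : b \in [set (hit_end h u).2 | u in D].
  case/imsetP => u; rewrite inE => /andP[uP /eqP ej] eb.
  have /negP[] := no u; rewrite uP /= eb -ej.
  by rewrite -surjective_pairing.
suff -> : [set (hit_end h u).2 | u in D] = setT by [].
by apply/eqP; rewrite eqEcard subsetT cardsT card_bool (card_in_imset (inj j)) -c2 leqnn.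
Qed.

Section Family.
Variables (d : nat) (F : {set I}) (t : I -> switching) (h : I -> hitting).
Hypothesis FS : F \subset S.
Hypothesis Ft : forall k, k \in F -> switched d k (t k).
Hypothesis Fh : forall k, k \in F -> hits k (sw_new (t k)) (h k).

(** When k hits the edge of i twice and i hits that of k through u, a third colour
j also hitting the edge of i twice would give the exchange [rainbow_rotate],
unless k was changed on the way to j, or one of the outer vertices collides with
those used by j. *)
Lemma few_mutual_hits i : i \in F ->
  #|[set k in F | [&& hit_count (h k) i == 2, 0 < hit_count (h i) k
                    & i \notin sw_changed (t k)]]| <= 4 * d.+1 * d.+2.
Proof.
move=> iF; have iS := subsetP FS i iF.
pose J := [set k in F | (hit_count (h k) i == 2) && (i \notin sw_changed (t k))].
(* B b k collects the outer vertices that are used up once colour k has lost its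
   edge by switching and then taken the end b of the edge of i. *)
pose B b k := hitter (h k) (i, b) |: sw_new (t k).
have JP k b : k \in J -> hitter (h k) (i, b) \in hitters (h k) /\
    hit_end (h k) (hitter (h k) (i, b)) = (i, b).
  by rewrite inE => /and3P[/Fh hk /eqP c2 _]; apply: hitterP hk c2.
have cB b k : k \in J -> #|B b k| <= d.+1.
  rewrite inE => /and3P[/Ft[_ _ [cT _] _ _] _ _]; rewrite cardsU1.
  by case: (_ \notin _); lia.
have hitVT k u : k \in F -> u \in hitters (h k) -> u \notin V :|: sw_new (t k).
  by move=> /Fh[dis _ _ _]; apply: dis.
have core b : exists J' : {set I}, [/\ J' \subset J, #|J'| <= d.+2
    & forall x, (forall j, j \in J' -> x \in B b j) ->
                forall j, j \in J -> x \in B b j].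
  by apply: small_subfamily_same_inter => k; apply: cB.
have [J' J'P] := fin_all_exists core.
(* With j restricted to J' b, the colours excluded by a change of colour or by a
   collision with u are bounded in number. *)
pose R b := \bigcup_(j in J' b)
  (sw_changed (t j) :|: [set (hit_end (h i) u).1 | u in B b j]).
have cR b : #|R b| <= d.+2 * (2 * d.+1).
  have [/subsetP J'J cJ' _] := J'P b.
  apply: leq_trans (_ : #|J' b| * (2 * d.+1) <= _); last by rewrite leq_mul2r cJ' orbT.
  apply: card_bigcup_le => j /J'J jJ.
  have [+ _] := leq_card_setU (sw_changed (t j)) [set (hit_end (h i) u).1 | u in B b j].
  move=> /leq_trans-> //; have := leq_imset_card (fun u => (hit_end (h i) u).1) (B b j).
  have := cB b j jJ; move: jJ; rewrite inE => /and3P[/Ft[_ _ [_ cC] _ _] _ _]; lia.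
apply: leq_trans (_ : #|R true :|: R false| <= _); last first.
  have [+ _] := leq_card_setU (R true) (R false).
  by have := cR true; have := cR false; lia.
apply/subset_leq_card/subsetP => k; rewrite inE => /and4P[kF c2 hik ik].
have kJ : k \in J by rewrite inE kF c2 ik.
have [u] : exists u, u \in [set u in hitters (h i) | (hit_end (h i) u).1 == k].
  by apply/card_gt0P.
rewrite inE => /andP[uP /eqP uk].
(* Colour k should take the end ~~ b with an outer vertex other than u: the two
   outer vertices by which k hits the edge of i are distinct. *)
have [b nu] : exists b, u != hitter (h k) (i, ~~ b).
  have [e|] := eqVneq u (hitter (h k) (i, true)); last by exists false.
  exists true; rewrite e; apply/eqP => /(congr1 (hit_end (h k))).
  by have [_ ->] := JP k true kJ; have [_ ->] := JP k false kJ.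
suff : k \in R b by case: (b); rewrite inE => ->; rewrite ?orbT.
set y := hitter (h k) (i, ~~ b) in nu *.
have [yP ye] := JP k (~~ b) kJ.
have yB : y \notin B b k.
  rewrite in_setU1 negb_or; have := hitVT k y kF yP; rewrite in_setU negb_or => /andP[_ ->].
  rewrite andbT; apply/eqP => /(congr1 (hit_end (h k))).
  by rewrite ye; have [_ ->] := JP k b kJ; case: (b).
(* y is not in B b k and k is in J, so some member of the core also avoids y. *)
have [/subsetP J'J _ J'B] := J'P b.
have /existsP[j /andP[jJ' yj]] : [exists j, (j \in J' b) && (y \notin B b j)].
  apply: contraT; rewrite negb_exists => /forallP all.
  case/negP: yB; apply: J'B => // j jJ'.
  by have := all j; rewrite jJ' negbK.
apply/bigcupP; exists j => //; apply: contraT.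
rewrite in_setU negb_or => /andP[kC uB].
have jJ := J'J j jJ'; have := jJ; rewrite inE => /and3P[jF _ iC].
have uj : u \notin B b j.
  by apply: contraNN uB => uB; rewrite -uk; apply: (imset_f (fun u => (hit_end (h i) u).1)).
have [rm /subsetP cm _ [jC zC] eqm] := Ft jF.
have [xP xe] := JP j b jJ.
have kC' : k \in sw_changed (t k) by have [_ _ _ []] := Ft kF.
have unc v : v \notin V -> v \notin B b j -> v \notin covered (S :\ j) (sw_matching (t j)).
  move=> vV vB; apply: contraNN vB => /cm; rewrite in_setU (negPf vV) => vT.
  by rewrite in_setU1 [_ \in sw_new _]vT orbT.
have notV l v : l \in F -> v \in hitters (h l) -> v \notin V.
  by move=> lF /(hitVT l v lF); rewrite in_setU negb_or => /andP[].
have hitA l v p : l \in F -> v \in hitters (h l) -> hit_end (h l) v = p ->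
    p.1 \notin sw_changed (t j) -> A l (sw_matching (t j) p) v.
  by move=> /Fh[_ _ _ hA] vP ve pC; rewrite eqm // -ve; apply: hA.
have [m rS] : exists m, rainbow_on S m.
  have uke : hit_end (h i) u = (k, (hit_end (h i) u).2).
    by rewrite -uk -surjective_pairing.
  apply: (rainbow_rotate (i := i) (j := j) (k := k) (b := b)
            (c := (hit_end (h i) u).2)
            (x := hitter (h j) (i, b)) (y := y) (w := u) rm) => //.
  - exact: (subsetP FS).
  - by apply: contraNneq iC => ->.
  - by apply: contraNneq kC => ->.
  - by apply: contraNneq ik => ->.
  - exact: hitA.
  - exact: hitA.
  - exact: hitA.
  - apply: contraNN (hitVT j _ jF xP); exact: cm.
  - by apply: unc => //; apply: notV yP.
  - by apply: unc => //; apply: notV uP.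
  - by apply: contraNneq yj => <-; rewrite setU11.
  - by apply: contraNneq uj => <-; rewrite setU11.
  - by rewrite eq_sym.
by have := stuck m; rewrite rS.
Qed.

End Family.
(** Quantifying over finite types makes the existence of a [switched] matching
boolean. *)
Definition switchable d : {set I} :=
  [set i in S | [exists m : matching, exists T : {set X}, exists C : {set I},
    [&& rainbow_on (S :\ i) m, covered (S :\ i) m \subset V :|: T,
        #|T| <= d, #|C| <= d.+1, i \in C, z \in C
      & [forall p, (p.1 \notin C) ==> (m p == f p)]]]].

Lemma switchableP d i :
  reflect (i \in S /\ exists t, switched d i t) (i \in switchable d).
Proof.
rewrite inE; apply: (iffP andP) => -[iS].
  case/existsP=> m /existsP[T /existsP[C /and5P[rm cm cT cC /and3P[iC zC /forallP eqm]]]].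
  by split=> //; exists (Switching m T C); split=> //= p pC; apply/eqP/(implyP (eqm p)).
case=> -[m T C] [/= rm cm [cT cC] [iC zC] eqm]; split=> //.
apply/existsP; exists m; apply/existsP; exists T; apply/existsP; exists C.
rewrite rm cm cT cC iC zC /=; apply/forallP => p; apply/implyP => pC.
by rewrite eqm.
Qed.

Lemma switchedW d i t : switched d i t -> switched d.+1 i t.
Proof. by case=> ? ? [/leqW ? /leqW ?]. Qed.

Lemma switchableW d : switchable d \subset switchable d.+1.
Proof.
apply/subsetP => i /switchableP[iS [t it]]; apply/switchableP.
by split=> //; exists t; apply: switchedW.
Qed.

Lemma base_switchable d : z \in switchable d.
Proof.
elim: d => [|d]; last exact/subsetP/switchableW.
by apply/switchableP; split=> //; eexists; apply: switched_id.
Qed.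

(** The lower bound on the number of hits from [exists_hitting] meets the upper
bound from [hits_double_counting]. *)
Lemma stuck_bound d q : (forall i, i \in S -> q <= #|kernel (A i)|) ->
  q + #|switchable d| <=
  2 * #|switchable d.+1| + 2 * #|S|.-1 + 2 * d + 3 * d.+1 + 4 * d.+1 * d.+2.
Proof.
move=> Kq; set F := switchable d; set F' := switchable d.+1.
have FS : F \subset S by apply/subsetP => i /switchableP[].
have fam k : exists th : switching * hitting, k \in F ->
    [/\ switched d k th.1, hits k (sw_new th.1) th.2
      & q - (2 * #|S|.-1 + 2 * d) <= #|hitters th.2|].
  have [kF|] := boolP (k \in F); last first.
    by exists (Switching f set0 set0, Hitting set0 (fun=> (z, true))).
  have /switchableP[kS [t kt]] := kF.
  have [h hk ch] := exists_hitting kS kt.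
  by exists (t, h); split=> //=; have := Kq k kS; lia.
have [th thP] := fin_all_exists fam.
pose t k := (th k).1; pose h k := (th k).2.
have Ft k : k \in F -> switched d k (t k) by move=> /thP[].
have Fh k : k \in F -> hits k (sw_new (t k)) (h k) by move=> /thP[].
have FC k : k \in F -> #|sw_changed (t k)| <= d.+1 by move=> /Ft[_ _ []].
suff : (q - (2 * #|S|.-1 + 2 * d)) + #|F| <= 2 * #|F'| + 3 * d.+1 + 4 * d.+1 * d.+2.
  lia.
apply: (hits_double_counting (hit := fun k => hit_count (h k))
                     (C := fun k => sw_changed (t k))) => //.
- by apply/set0Pn; exists z; apply: base_switchable.
- exact: switchableW.
- by move=> k i /Fh; apply: hit_count_le2.
- by move=> k /thP[_ _ ch]; rewrite -sum_hit_count.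
- move=> k i kF iC /card_gt0P[u]; rewrite inE => /andP[uP /eqP ui].
  have [dis _ inS hA] := Fh k kF.
  have iS : i \in S by move: (inS u uP); rewrite ui inE => /andP[].
  apply/switchableP; split=> //.
  apply: (switched_step (b := (hit_end (h k) u).2) (Ft k kF) iS iC (dis u uP)).
  by rewrite -ui -surjective_pairing; apply: hA.
- by move=> i iF; apply: few_mutual_hits FS Ft Fh i iF.
Qed.

(** Five increments of more than n / 5 would exceed the number of colours. *)
Lemma slow_level (n : nat) : #|S| <= n ->
  exists2 d, d < 5 & 5 * #|switchable d.+1| <= 5 * #|switchable d| + n.
Proof.
move=> Sn; have /existsP[d le] : [exists d : 'I_5,
    5 * #|switchable d.+1| <= 5 * #|switchable d| + n]; last by exists d.
apply: contraT; rewrite negb_exists => /forallP up.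
have: #|switchable 5| <= #|S| by apply/subset_leq_card/subsetP => i /switchableP[].
move: (up (@Ordinal 5 0 isT)) (up (@Ordinal 5 1 isT)) (up (@Ordinal 5 2 isT))
      (up (@Ordinal 5 3 isT)) (up (@Ordinal 5 4 isT)).
by rewrite -!ltnNge /=; lia.
Qed.

(** Here d <= 4, so the error terms of [stuck_bound] are at most 8 + 15 + 120, and
they are multiplied by 5. *)
Lemma stuck_kernels (n q : nat) :
  #|S| <= n -> 16 * n + 710 <= 5 * q ->
  ~ (forall i, i \in S -> q <= #|kernel (A i)|).
Proof.
move=> Sn qn Kq; have [d d5 slow] := slow_level Sn.
have S_gt0 : 0 < #|S| by apply/card_gt0P; exists z.
have FS : #|switchable d.+1| <= #|S| by apply/subset_leq_card/subsetP => i /switchableP[].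
have := stuck_bound d Kq.
have : 4 * d.+1 * d.+2 <= 4 * 5 * 6 by rewrite !leq_mul.
lia.
Qed.

End Switching.

Lemma exists_rainbow (n q : nat) (x0 : X) S :
  #|S| <= n -> 16 * n + 710 <= 5 * q ->
  (forall i, i \in S -> q <= #|kernel (A i)|) -> exists m, rainbow_on S m.
Proof.
move=> Sn qn; move Es : #|S| => s; elim: s S Es Sn => [|s IH] S Es Sn Kq.
  exists [ffun=> x0]; rewrite (cards0_eq Es).
  by apply/rainbow_onP; split=> [i|p]; rewrite inE.
have [z zS] : exists z, z \in S by apply/card_gt0P; rewrite Es.
have Ez : #|S :\ z| = s by move: Es; rewrite (cardsD1 z S) zS => -[].
have [|i /setD1P[_ /Kq //]|f rf] := IH _ Ez; first by rewrite Ez ltnW -?Es.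
apply/existsP; apply: contraT; rewrite negb_exists => /forallP stuck.
by case: (stuck_kernels zS rf stuck Sn qn).
Qed.

End Matchings.

Import Order.TTheory GRing.Theory Num.Theory.
Local Open Scope ring_scope.

Theorem theorem1 :
  exists c : rat,
    forall n : nat, (0 < n)%N ->
    forall (X : finType) (A : 'I_n -> rel X),
      (forall i : 'I_n, equivalence_rel (A i)) ->
      (forall i : 'I_n, (3 + 1 / 5) * n%:R + c <= #|kernel (A i)|%:R :> rat) ->
      has_rainbow_matching A.
Proof.
exists 142%:R => n n_gt0 X A A_equiv K_large.
have K5 i : (16 * n + 710 <= 5 * #|kernel (A i)|)%N.
  by rewrite -(ler_nat rat) natrD !natrM; have := K_large i; lra.
have [x0 _] : exists x0, x0 \in kernel (A (Ordinal n_gt0)).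
  by apply/card_gt0P; have := K5 (Ordinal n_gt0); lia.
(* The least q with 16 n + 710 <= 5 q. *)
pose q := ((16 * n + 714) %/ 5)%N.
have [||i _|m /rainbow_onP[mA m_inj]] := @exists_rainbow _ _ _ A_equiv n q x0 setT.
- by rewrite cardsT card_ord.
- by rewrite /q; lia.
- by have := K5 i; rewrite /q; lia.
exists (fun i => m (i, true)), (fun i => m (i, false)); split.
- by move=> i j /m_inj; rewrite !inE => /(_ isT isT) [].
- by move=> i j /m_inj; rewrite !inE => /(_ isT isT) [].
- by move=> i j; apply/eqP => /m_inj; rewrite !inE => /(_ isT isT).
- by move=> i; apply: mA; rewrite inE.
Qed.
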